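(* Let $(X,T)$ be a topological dynamical system. The following are equivalent: (i) $(X,T)$ is uniformly rigid; (ii) there exists an IP-set $A\subset\mathbb{N}$ such that $(X,T)$ is $A$-equicontinuous; (iii) there exists a subsequence $A$ of $\mathbb{N}$ such that $(X,T)$ is $A$-equicontinuous.
   Context: A topological dynamical system $(X,T)$ is a non-empty compact metric space $X$ with metric $d$ together with a homeomorphism $T:X\to X$. $\mathbb{N}$ denotes the non-negative integers. A subsequence $A=\{a_i:i\in\mathbb{N}\}$ of $\mathbb{N}$ is an infinite set of natural numbers listed in strictly increasing order. $(X,T)$ is uniformly rigid if there is a subsequence $\{t_k\}$ of $\mathbb{N}$ such that $T^{t_k}\to \mathrm{id}$ uniformly on $X$. For a sequence $\{b_i:i\in\mathbb{N}\}$ of positive integers let $FS\{b_i\}=\{b_{i_1}+\cdots+b_{i_k}: i_1<\cdots<i_k,\ k\geq 1\}$. A set $F\subset\mathbb{N}$ is an IP-set if $F=FS\{b_i\}$ for some such $\{b_i\}$; an IP-set is regarded as a subsequence of $\mathbb{N}$ by listing its elements in increasing order. For a subsequence $A=\{a_i\}$ of $\mathbb{N}$, $(X,T)$ is $A$-equicontinuous if for every $\epsilon>0$ there is $\delta>0$ such that for all $x,y\in X$ with $d(x,y)<\delta$ one has $d(T^{a_n}x,T^{a_n}y)<\epsilon$ for all $n\in\mathbb{N}$. *)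

(* Defs.v *)
From HB Require Import structures.
From mathcomp Require Import all_boot all_order all_algebra.
From mathcomp Require Import all_classical all_reals all_analysis.

Set Implicit Arguments.
Unset Strict Implicit.
Unset Printing Implicit Defensive.

Import Order.TTheory GRing.Theory Num.Theory.

Local Open Scope classical_set_scope.
Local Open Scope ring_scope.

Definition homeomorphism (X Y : topologicalType) (f : X -> Y) : Prop :=
  continuous f /\
  exists g : Y -> X, [/\ cancel f g, cancel g f & continuous g].

Definition topological_dynamical_system (R : realType) (X : metricType R)
    (T : X -> X) : Prop :=
  [/\ [set: X] !=set0, compact [set: X] & homeomorphism T].

(* [increasing_seq] is strict monotonicity: [a n <= a m] iff [n <= m]. *)
Definition increasing_listing (A : set nat) (a : nat -> nat) : Prop :=
  increasing_seq a /\ range a = A.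

Definition uniformly_rigid (R : realType) (X : metricType R)
    (T : X -> X) : Prop :=
  exists t : nat -> nat, increasing_seq t /\
    {uniform, (fun k : nat => iter (t k) T) @ \oo --> (id : X -> X)}.

Definition FS (b : nat -> nat) : set nat :=
  [set m | exists s : seq nat,
     [/\ s <> [::], sorted ltn s & m = (\sum_(i <- s) b i)%N]].

Definition IP_set (F : set nat) : Prop :=
  exists b : nat -> nat, (forall i, (0 < b i)%N) /\ F = FS b.

Definition seq_equicontinuous (R : realType) (X : metricType R) (T : X -> X)
    (a : nat -> nat) : Prop :=
  forall eps : R, 0 < eps -> exists delta : R, 0 < delta /\
    forall x y : X, mdist x y < delta ->
    forall n : nat, mdist (iter (a n) T x) (iter (a n) T y) < eps.

(* Main.v *)
Require Import Defs.
From HB Require Import structures.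
From mathcomp Require Import all_boot all_order all_algebra.
From mathcomp Require Import all_classical all_reals all_analysis.
From mathcomp Require Import lra.

(** Uniform rigidity says that the identity is a uniform limit of the powers
[T ^ t] with [t -> oo].  Since such an approximation is only asked for one
[eps] and one lower bound on [t] at a time, rigidity reduces to: for all
[eps > 0] and [N] some [t >= N] has [d (T ^ t x) x < eps] for every [x]
([uniformly_rigidP]).

(iii) => (i).  On a compact space an equicontinuous family of maps is totally
bounded for the uniform distance: up to a small error, a member is determined
by which points of a finite net lie near the images of the points of another
finite net, and only finitely many such patterns exist.  Hence two of the maps
[T ^ a_n], with exponents at distance at least [N], are uniformly close
([seq_equicontinuous_close]).  As [T] is onto, the smaller power can be
cancelled, which leaves a power [T ^ t] with [t >= N] uniformly close to the
identity.

(i) => (ii).  Choose [b_i > 0] with [T ^ b_i] within [2 ^ -i] of the identity.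
A finite sum of the [b_i] splits into the part with [i <= N], which takes
boundedly many values, and the part with [i > N], which moves every point by
at most [2 ^ -N] because errors add up along a composition.  The first part
thus contributes finitely many uniformly continuous maps, and the second is
close to the identity, so the powers of [T] along the finite sums are
equicontinuous ([FS_equicontinuous]). *)

Set Implicit Arguments.
Unset Strict Implicit.
Unset Printing Implicit Defensive.

Import Order.TTheory GRing.Theory Num.Theory.

Local Open Scope classical_set_scope.
Local Open Scope ring_scope.

(** * Sequences of natural numbers *)

Lemma leq_add_increasing (a : nat -> nat) (m n : nat) :
  increasing_seq a -> (a m + n <= a (m + n))%N.
Proof.
move=> aI; elim: n => [|n IHn]; first by rewrite !addn0.
have aS : (a (m + n) < a (m + n).+1)%N.
  by have := leW_mono aI (m + n)%N (m + n).+1; rewrite ltEnat /= ltnS leqnn.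
by rewrite !addnS (leq_ltn_trans IHn).
Qed.

Lemma pigeonhole_nat (F : finType) (u : nat -> F) :
  exists m n : nat, (m < n)%N /\ u m = u n.
Proof.
apply: contrapT => noM.
have uI : injective (fun i : 'I_#|F|.+1 => u i).
  move=> i j uij; apply/val_inj; apply: contrapT => ij; apply: noM.
  have [lt_ij|lt_ji|//] := ltngtP i j; first by exists i, j.
  by exists j, i.
by have := leq_card _ uI; rewrite card_ord ltnn.
Qed.

(** Each term is the least element of the set above the previous one. *)
Lemma increasing_listing_exists (A : set nat) :
  (forall N, exists2 m, A m & (N <= m)%N) -> exists a, increasing_listing A a.
Proof.
move=> Aoo.
have /choice[next nextP] N : exists x, [/\ A x, (N <= x)%N &
    forall m, A m -> (N <= m)%N -> (x <= m)%N].
  have exA : exists m, `[< A m >] && (N <= m)%N.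
    by have [m Am Nm] := Aoo N; exists m; rewrite Nm andbT; apply/asboolP.
  case: (ex_minnP exA) => m /andP[/asboolP Am Nm] minm.
  exists m; split=> // k Ak Nk; apply: minm.
  by rewrite Nk andbT; apply/asboolP.
pose a := fix a n := if n is k.+1 then next (a k).+1 else next 0%N.
have aI : increasing_seq a.
  by apply/increasing_seqP => n; have [] := nextP (a n).+1.
exists a; split=> //; apply/seteqP; split=> [_ [n _ <-]|m Am].
  by case: n => [|n] /=; [have [] := nextP 0%N|have [] := nextP (a n).+1].
have ex_am : exists n, (m <= a n)%N.
  by exists m; apply: leq_trans (leq_add_increasing 0 m aI); rewrite leq_addl.
case: (ex_minnP ex_am) => n le_man minn; exists n => //.
apply/eqP; rewrite eqn_leq le_man andbT.
case: n {le_man} minn => [|n] minn /=; first by have [_ _] := nextP 0%N; exact.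
have [_ _] := nextP (a n).+1; apply=> //.
by rewrite ltnNge; apply/negP => /minn; rewrite ltnn.
Qed.

Lemma FS_unbounded (b : nat -> nat) (N : nat) :
  (forall i, 0 < b i)%N -> exists2 m, FS b m & (N <= m)%N.
Proof.
move=> b0; exists (\sum_(i <- iota 0 N.+1) b i)%N.
  by exists (iota 0 N.+1); split=> //; exact: iota_ltn_sorted.
rewrite ltnW// -[X in (X <= _)%N](size_iota 0 N.+1) -sum1_size.
by apply: leq_sum => i _; exact: b0.
Qed.

Lemma sum_exp2V_path (R : realType) (N : nat) (s : seq nat) :
  path ltn N s -> \sum_(i <- s) (2 ^- i : R) <= 2 ^- N.
Proof.
elim: s N => [|i s IHs] N /=; first by rewrite big_nil invr_ge0 exprn_ge0.
move=> /andP[Ni /IHs les]; rewrite big_cons.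
(* [i >= N + 1] and the later terms sum to at most [2 ^- i]. *)
apply: (@le_trans _ _ (2 ^- N.+1 *+ 2)); last first.
  by rewrite -[_ *+ 2]mulr_natr exprSr invfM mulrAC -mulrA mulfV// mulr1.
rewrite mulr2n; have le_iN : 2 ^- i <= 2 ^- N.+1 :> R.
  by rewrite lef_pV2 ?posrE ?exprn_gt0// ler_weXn2l// ler1n.
by rewrite lerD// (le_trans les).
Qed.

(** * Compact metric spaces *)

(** The covering property is applied to the finite sequences of points,
directed by inclusion. *)
Lemma compact_net (R : realType) (X : metricType R) (eps : R) :
  compact [set: X] -> 0 < eps ->
  exists k (c : 'I_k -> X), forall x, exists i, mdist (c i) x < eps.
Proof.
move=> /compact_near_coveringP cX e0.
pose F : set_system (seq X) :=
  filter_from setT (fun s0 : seq X => [set s : seq X | {subset s0 <= s}]).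
have FF : Filter F.
  apply: filter_from_filter; first by exists [::].
  move=> s1 s2 _ _; exists (s1 ++ s2) => // s sub; split=> z zs; apply: sub.
    by rewrite mem_cat zs.
  by rewrite mem_cat zs orbT.
have [|s _ /(_ s (fun _ => id)) sP] :=
    cX _ F (fun s x => exists2 y, y \in s & mdist y x < eps) FF.
  move=> x _; exists (ball x eps, [set s : seq X | {subset [:: x] <= s}]).
    by split; [exact: nbhsx_ballx|exists [:: x]].
  move=> [y s] [] /=; rewrite ballEmdist /= => xy xs.
  by exists x => //; apply: xs; rewrite mem_head.
exists (size s), (tnth (in_tuple s)) => x; have [y ys yx] := sP x I.
by have /tnthP[i def_y] : y \in in_tuple s by []; exists i; rewrite -def_y.
Qed.

(** Every point has a ball on which a small enough radius works, so
compactness makes one small enough radius work everywhere. *)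
Lemma compact_mdist_unif_continuous (R : realType) (X : metricType R)
    (f : X -> X) :
  compact [set: X] -> continuous f ->
  forall eps, 0 < eps -> exists delta, 0 < delta /\
    forall x y, mdist x y < delta -> mdist (f x) (f y) < eps.
Proof.
move=> /compact_near_coveringP cX cf eps e0.
have e20 : 0 < eps / 2 by rewrite divr_gt0.
have [|r r0 /(_ (r / 2))] := cX R 0^'+
    (fun r x => forall y, mdist x y < r -> mdist (f x) (f y) < eps) _.
  move=> x _.
  have /nbhs_ballP[r /= r0 rP] := cf x _ (nbhsx_ballx (f x) _ e20).
  have r20 : 0 < r / 2 by rewrite divr_gt0.
  exists (ball x (r / 2), [set q | q < r / 2]).
    by split; [exact: nbhsx_ballx|exact: nbhs_right_lt].
  move=> [y q] [] /=; rewrite ballEmdist /= => xy qr z yz.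
  have fy : mdist (f x) (f y) < eps / 2.
    have := rP y; rewrite !ballEmdist /=; apply; lra.
  have fz : mdist (f x) (f z) < eps / 2.
    have := rP z; rewrite !ballEmdist /=; apply.
    have := metric_triangle x y z; lra.
  have := metric_triangle (f y) (f x) (f z).
  rewrite (metric_sym (f y) (f x)); lra.
rewrite /= in r0 *; move=> rP; exists (r / 2); split; first by rewrite divr_gt0.
move=> x y xy; apply: rP xy => //=; last by rewrite divr_gt0.
rewrite sub0r normrN gtr0_norm ?divr_gt0//; lra.
Qed.

Lemma iter_unif_continuous (R : realType) (X : metricType R) (T : X -> X)
    (M : nat) :
  compact [set: X] -> continuous T ->
  forall eps, 0 < eps -> exists delta, 0 < delta /\
    forall x y, mdist x y < delta ->
    forall m, (m <= M)%N -> mdist (iter m T x) (iter m T y) < eps.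
Proof.
move=> cX cT; elim: M => [|M IHM] eps e0.
  by exists eps; split=> // x y xy m; rewrite leqn0 => /eqP ->.
have [d [d0 dP]] := compact_mdist_unif_continuous cX cT e0.
have [d' [d'0 d'P]] : exists d', 0 < d' /\ forall x y, mdist x y < d' ->
    forall m, (m <= M)%N ->
    mdist (iter m T x) (iter m T y) < Num.min eps d.
  by apply: IHM; rewrite lt_min e0 d0.
exists d'; split=> // x y xy m.
rewrite leq_eqVlt => /orP[/eqP ->|mM].
  by apply: dP; have := d'P _ _ xy M (leqnn M); rewrite lt_min => /andP[].
by have := d'P _ _ xy m mM; rewrite lt_min => /andP[].
Qed.

(** * Uniform rigidity *)

Lemma uniform_cvg_mdistP (R : realType) (X : metricType R)
    (g : nat -> X -> X) (f : X -> X) :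
  {uniform, g @ \oo --> f} <->
  forall eps : R, 0 < eps ->
    \forall k \near \oo, forall x, mdist (f x) (g k x) < eps.
Proof.
split=> [gf eps e0|gf P /uniform_nbhs[E [entE EP]]].
  apply: (gf [set h | forall x, mdist (f x) (h x) < eps]).
  apply/uniform_nbhs; exists [set xy | ball xy.1 eps xy.2]; split.
    by rewrite -entourage_ballE; exists eps.
  by move=> h hP x; have := hP x I; rewrite /= ballEmdist.
move: entE; rewrite -entourage_ballE => -[eps /= e0 epsE].
suff: \forall k \near \oo, P (g k) by [].
apply: filterS (gf _ e0) => k kP; apply: EP => x _.
by apply: epsE; rewrite /= ballEmdist; exact: kP.
Qed.

Lemma exp2V_lt (R : realType) (eps : R) :
  0 < eps -> \forall n \near \oo, 2 ^- n < eps.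
Proof.
move=> e0; apply: filterS (near_infty_natSinv_expn_lt (PosNum e0)) => n /=.
by rewrite div1r.
Qed.

Lemma uniformly_rigidP (R : realType) (X : metricType R) (T : X -> X) :
  uniformly_rigid T <->
  forall (eps : R) (N : nat), 0 < eps ->
    exists2 t, (N <= t)%N & forall x, mdist (iter t T x) x < eps.
Proof.
split=> [[t [tI /uniform_cvg_mdistP tT]] eps N e0|rT].
  have [K _ KP] := tT _ e0; exists (t (K + N)%N).
    by apply: leq_trans (leq_add_increasing 0 _ tI); rewrite addnA leq_addl.
  by move=> x; rewrite metric_sym; apply: KP; rewrite /= leq_addr.
have /choice[c cP] (p : nat * nat) : exists t,
    (p.2 <= t)%N /\ forall x, mdist (iter t T x) x < 2 ^- p.1.
  have k0 : 0 < 2 ^- p.1 :> R by rewrite invr_gt0 exprn_gt0.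
  by have [t] := rT _ p.2 k0; exists t.
pose t := fix t n := if n is k.+1 then c (k.+1, (t k).+1) else c (0, 0)%N.
exists t; split.
  by apply/increasing_seqP => n; have [] := cP (n.+1, (t n).+1).
have tP k x : mdist (iter (t k) T x) x < 2 ^- k.
  by case: k => [|k] /=; [have [] := cP (0, 0)%N|have [] := cP (k.+1, (t k).+1)].
apply/uniform_cvg_mdistP => eps e0; apply: filterS (exp2V_lt e0) => k ke x.
by rewrite metric_sym (lt_trans (tP k x)).
Qed.

(** Two maps of the family that send each net point [c i] near the same net
point [c' j] are uniformly close, by equicontinuity. *)
Lemma seq_equicontinuous_close (R : realType) (X : metricType R) (T : X -> X)
    (a : nat -> nat) :
  compact [set: X] -> seq_equicontinuous T a ->
  forall eps, 0 < eps -> exists m n : nat, (m < n)%N /\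
    forall x, mdist (iter (a n) T x) (iter (a m) T x) < eps.
Proof.
move=> cX eqT eps e0; have e40 : 0 < eps / 4 by rewrite divr_gt0.
have [d [d0 dP]] := eqT _ e40.
have [k [c cP]] := compact_net cX d0.
have [k' [c' c'P]] := compact_net cX e40.
have [code codeP] := choice c'P.
pose u n := [ffun i : 'I_k => code (iter (a n) T (c i))].
have [m [n [mn umn]]] := pigeonhole_nat u.
exists m, n; split=> // x; have [i cx] := cP x.
have /ffunP/(_ i) := umn; rewrite !ffunE => nij.
have := codeP (iter (a m) T (c i)); rewrite nij => c'm.
have c'n := codeP (iter (a n) T (c i)).
have xm := dP _ _ cx m; have xn := dP _ _ cx n.
move: c'm c'n xm xn.
set p := c' _; set q := iter (a m) T (c i); set r := iter (a n) T (c i).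
set y := iter (a m) T x; set z := iter (a n) T x => c'm c'n xm xn.
(* The path [z, r, p, q, y] has four steps shorter than [eps / 4]. *)
have := metric_triangle z r y; have := metric_triangle r p y.
have := metric_triangle p q y; rewrite (metric_sym z r) (metric_sym r p); lra.
Qed.

(** Closeness of [T ^ (a n)] and [T ^ (a m)] at a preimage of [x] under
[T ^ (a m)] is closeness of [T ^ (a n - a m)] to the identity at [x]. *)
Lemma seq_equicontinuous_rigid (R : realType) (X : metricType R) (T : X -> X)
    (a : nat -> nat) :
  topological_dynamical_system T -> increasing_seq a ->
  seq_equicontinuous T a -> uniformly_rigid T.
Proof.
move=> [_ cX [_ [S [_ TK _]]]] aI eqT; apply/uniformly_rigidP => eps N e0.
(* Exponents taken along the multiples of [N.+1] differ by more than [N]. *)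
have eqT' : seq_equicontinuous T (fun j => a (j * N.+1)%N).
  move=> e /eqT[d [d0 dP]]; exists d; split=> // x y xy n; exact: dP.
have [m [n [mn close]]] := seq_equicontinuous_close cX eqT' e0.
have le_N : (a (m * N.+1) + N <= a (n * N.+1))%N.
  apply: (leq_trans (leq_add_increasing _ N aI)).
  rewrite -leEnat aI; apply: (@leq_trans (m.+1 * N.+1)).
    by rewrite mulSn addnC leq_add2r.
  by rewrite leq_mul2r mn orbT.
have le_mn := leq_trans (leq_addr N _) le_N.
exists (a (n * N.+1) - a (m * N.+1))%N; first by rewrite leq_subRL.
move=> x; pose y := iter (a (m * N.+1)%N) S x.
have iterK j w : iter j T (iter j S w) = w.
  by elim: j w => // j IHj w; rewrite iterSr iterS TK IHj.
by have := close y; rewrite -{1}(subnK le_mn) iterD iterK.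
Qed.

(** * Finite sums of return times *)

Lemma mdist_iter_sum (R : realType) (X : metricType R) (T : X -> X)
    (b : nat -> nat) (e : nat -> R) :
  (forall i x, mdist (iter (b i) T x) x <= e i) ->
  forall (s : seq nat) x,
    mdist (iter (\sum_(i <- s) b i) T x) x <= \sum_(i <- s) e i.
Proof.
move=> be s x; elim: s => [|i s IHs]; first by rewrite !big_nil mdistxx.
rewrite !big_cons iterD.
by apply: le_trans (metric_triangle _ (iter (\sum_(i <- s) b i) T x) _) _;
  rewrite lerD.
Qed.

Lemma FS_equicontinuous (R : realType) (X : metricType R) (T : X -> X)
    (b a : nat -> nat) :
  compact [set: X] -> continuous T ->
  (forall i x, mdist (iter (b i) T x) x < 2 ^- i) -> range a `<=` FS b ->
  seq_equicontinuous T a.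
Proof.
move=> cX cT bT aFS eps e0; have e30 : 0 < eps / 3 by rewrite divr_gt0.
have [N _ /(_ N (leqnn N)) Ne] := exp2V_lt e30.
have [d [d0 dP]] :=
  iter_unif_continuous (\sum_(i <- iota 0 N.+1) b i) cX cT e30.
exists d; split=> // x y xy n.
have [s [_ s_sorted ->]] : FS b (a n) by apply: aFS; exists n.
rewrite (bigID (fun i => N < i)%N) /= -big_filter iterD iterD.
set m := (\sum_(i <- s | ~~ _) b i)%N.
have tail z :
    mdist (iter (\sum_(i <- [seq i <- s | (N < i)%N]) b i) T z) z < eps / 3.
  apply: le_lt_trans Ne; apply: (@le_trans _ _
      (\sum_(i <- [seq i <- s | (N < i)%N]) 2 ^- i)).
    by apply: (mdist_iter_sum (e := fun i => 2 ^- i)) => i w; exact: ltW.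
  apply: sum_exp2V_path; rewrite path_sortedE; last exact: ltn_trans.
  by rewrite filter_all sorted_filter //; exact: ltn_trans.
have le_m : (m <= \sum_(i <- iota 0 N.+1) b i)%N.
  rewrite /m -big_filter.
  apply: (uniq_sub_le_big leqnn (fun i j => leq_addr j i)).
  - exact: filter_uniq (sorted_uniq ltn_trans ltnn s_sorted).
  - exact: iota_uniq.
  - by move=> i; rewrite mem_filter -leqNgt mem_iota add0n ltnS => /andP[].
have head := dP _ _ xy _ le_m.
move: (tail (iter m T x)) (tail (iter m T y)) head.
set u := iter m T x; set v := iter m T y.
set u' := iter _ T u; set v' := iter _ T v => tu tv uv.
have := metric_triangle u' u v'; have := metric_triangle u v v'.
rewrite (metric_sym v v'); lra.
Qed.

Theorem theorem1p2 (R : realType) (X : metricType R) (T : X -> X)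
    (hT : topological_dynamical_system T) :
  [<-> (* (i) *)   uniformly_rigid T;
       (* (ii) *)  exists (A : set nat) (a : nat -> nat),
                     [/\ IP_set A, increasing_listing A a &
                         seq_equicontinuous T a];
       (* (iii) *) exists (A : set nat) (a : nat -> nat),
                     increasing_listing A a /\ seq_equicontinuous T a].
Proof.
tfae.
- move=> /uniformly_rigidP rT; have [_ cX [cT _]] := hT.
  have /choice[b bP] i : exists t,
      (0 < t)%N /\ forall x, mdist (iter t T x) x < 2 ^- i.
    have i0 : 0 < 2 ^- i :> R by rewrite invr_gt0 exprn_gt0.
    by have [t] := rT _ 1%N i0; exists t.
  have b0 i : (0 < b i)%N by have [] := bP i.
  have [a aFS] := increasing_listing_exists (fun N => FS_unbounded N b0).
  exists (FS b), a; split=> //; first by exists b.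
  apply: (FS_equicontinuous cX cT (b := b)) => [i|]; first by have [] := bP i.
  by rewrite aFS.2.
- by move=> [A [a [_ aA eqT]]]; exists A, a.
- by move=> [A [a [[aI _] eqT]]]; exact: seq_equicontinuous_rigid eqT.
Qed.
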